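(* Let $\widehat M$ be a cooperative Markov game with underlying MMDP $M$, let $(S_{target},S_{avoid})$ be a reach-avoid objective, and let $\pi=(\pi_{comm},\pi_{act})\in\Pi^{pos}_{comm}(\mathcal O,K)\times\Pi^{pos}_{act}(M)$. Assume $\sum_{t\ge1}H_t<\infty$. Then $$\mathbb P_{M_{\pi_{act}}}\big((\neg S_{avoid})\,\mathcal U\,S_{target}\big)-\mathbb P_{\widehat M_{\pi}}\big((\neg S_{avoid})\,\mathcal U\,S_{target}\big)\;\le\;\sqrt{1-\exp\big(-D_{(\pi_{comm},\pi_{act})}\big)} ,$$ where the right-hand side is read as $1$ if $D_{(\pi_{comm},\pi_{act})}=+\infty$.
   Context: MMDP: there are $N\ge1$ agents, identified with $[N]=\{1,\dots,N\}$. Agent $i$ has a finite local state set $\mathcal S^i$, finite local action set $\mathcal A^i$, local transition function $P^i:\mathcal S^i\times\mathcal A^i\to\Delta(\mathcal S^i)$ and initial local state $s^i_{init}$. Joint states $\mathcal S=\prod_i\mathcal S^i$, joint actions $\mathcal A=\prod_i\mathcal A^i$, joint transitions $P(s,a)(u)=\prod_{i}P^i(s^i,a^i)(u^i)$, initial state $s_{init}=(s^1_{init},\dots,s^N_{init})$. A positional joint action policy is a map $\pi_{act}:\mathcal S\to\Delta(\mathcal A)$; $\Pi^{pos}_{act}(M)$ is the set of these. Cooperative Markov game $\widehat M=(M,\mathcal O^1,\dots,\mathcal O^N,\mathcal L^1,\dots,\mathcal L^N,K)$: each $\mathcal S^i=\mathcal O^i\times\mathcal L^i$ (public part $o^i$,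 local part $l^i$); $\mathcal O=\prod_i\mathcal O^i$, $\mathcal L=\prod_i\mathcal L^i$, and a joint state is written $s=(o,l)$. For $c\subseteq[N]$, $\mathcal O^c=\prod_{j\in c}\mathcal O^j$, $\mathcal L^c=\prod_{j\in c}\mathcal L^j$, $\mathcal A^c=\prod_{j\in c}\mathcal A^j$, and $o^c,l^c,a^c$ denote restrictions to coordinates in $c$. $K\in\{0,\dots,N\}$ and $\mathcal A_{comm}$ is the set of subsets of $[N]$ of size $K$ (so $\mathcal A_{comm}=\{\emptyset\}$ if $K=0$). A positional communication policy is a map $\pi_{comm}:\mathcal O\to\Delta(\mathcal A_{comm})$; $\Pi^{pos}_{comm}(\mathcal O,K)$ is the set of these. Reach-avoid objective: disjoint sets $S_{target},S_{avoid}\subseteq\mathcal S$; put $\mathcal T=S_{target}\cup S_{avoid}$. Full-communication process $M_{\pi_{act}}$: random sequence $S_0=s_{init},A_1,S_1,A_2,S_2,\dots$ with $\mathbb P(A_t=a,S_t=s'\mid S_0,A_1,\dots,S_{t-1}=s)=\pi_{act}(s)(a)P(s,a)(s')$. Write $S_t=(O_t,L_t)$ and $A^c_t,O^c_t,L^c_t$ (resp. $A^i_t,O^i_t,L^i_t$) for components in $c$ (resp. $i$). The process is regarded as stopped upon entering $\mathcal T$: with $E_{t}=\{S_0,\dots,S_{t}\notin\mathcal T\}$, every probability of an event concerning times $t-1,t$ is the probability of that event intersected with $E_{t-1}$, and conditional probabilities condition on the conditioning event intersected with $E_{t-1}$. For $c\subseteq[N]$ and $t\ge1$ let $q^c_t(a^c,o^c_1,l^c_1\mid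 o,l^c)=\mathbb P(A^c_t=a^c,O^c_t=o^c_1,L^c_t=l^c_1\mid O_{t-1}=o,L^c_{t-1}=l^c,E_{t-1})$ (write $q^i_t$ for $c=\{i\}$; arbitrary if the conditioning event has probability $0$). Restricted-communication process $\widehat M_\pi$, $\pi=(\pi_{comm},\pi_{act})$: random sequence $\hat S_0=s_{init},\hat A_1,\hat S_1,\dots$ (stopped upon entering $\mathcal T$) such that for any history ending in $\hat S_{t-1}=(o,l)\notin\mathcal T$, $\mathbb P(\hat A_t=a,\hat S_t=(o_1,l_1)\mid\text{history})=\sum_{c\in\mathcal A_{comm}}\pi_{comm}(o)(c)\,q^c_t(a^c,o^c_1,l^c_1\mid o,l^c)\prod_{i\notin c}q^i_t(a^i,o^i_1,l^i_1\mid o,l^i)$ (the factor for $c=\emptyset$ is $1$). $\mathbb P_{X}((\neg S_{avoid})\mathcal U S_{target})$ for a process $X$ is the probability that some state at time $t$ lies in $S_{target}$ while no state at times $<t$ lies in $S_{avoid}$. Cost: $H_t=H(A_tS_t\mid S_0A_1S_1\dots A_{t-1}S_{t-1})$ is the conditional entropy of the (stopped) full-communication process, i.e. $-\sum_{h}\mathbb P(h\cap E_{t-1})\sum_{a,s'}p_h(a,s')\log p_h(a,s')$ over histories $h$ of length $t-1$, with $p_h$ the conditional law of $(A_t,S_t)$ given $h$. With $w'(o,i)=\sum_{c\in\mathcal A_{comm},\,i\notin c}\pi_{comm}(o)(c)$ and $w''(o,c)=\pi_{comm}(o)(c)$: $G^i=\sum_{t\ge1}\sum_{o\in\mathcal O,l^i\in\mathcal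 L^i}w'(o,i)\,\mathbb P(O_{t-1}=o,L^i_{t-1}=l^i,E_{t-1})\Big(-\sum_{a^i,o^i_1,l^i_1}q^i_t\log q^i_t\Big)$, where $q^i_t=q^i_t(a^i,o^i_1,l^i_1\mid o,l^i)$; $G^c=\sum_{t\ge1}\sum_{o\in\mathcal O,l^c\in\mathcal L^c}w''(o,c)\,\mathbb P(O_{t-1}=o,L^c_{t-1}=l^c,E_{t-1})\Big(-\sum_{a^c,o^c_1,l^c_1}q^c_t\log q^c_t\Big)$; $D_{(\pi_{comm},\pi_{act})}=\sum_{i\in[N]}G^i+\sum_{c\in\mathcal A_{comm}}G^c-\sum_{t\ge1}H_t$. Convention $0\log0=0$. *)

(* Defs.v *)
From HB Require Import structures.
From mathcomp Require Import all_boot all_order all_algebra.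
From mathcomp Require Import all_classical all_reals all_analysis.
Unset Printing Implicit Defensive.
Import Order.TTheory GRing.Theory Num.Theory.
Local Open Scope ring_scope.

Definition is_dist (R : realType) (X : finType) (f : {ffun X -> R}) : Prop :=
  (forall x, 0 <= f x) /\ \sum_(x : X) f x = 1.

Definition xlnx (R : realType) (x : R) : R := if x == 0 then 0 else x * ln x.

Definition entr (R : realType) (X : finType) (p : X -> R) : R :=
  - \sum_(x : X) xlnx R (p x).

Section Game.
Context (R : realType) (N : nat) (O L A : 'I_N -> finType) (K : nat).

(* joint public states, joint local parts, joint actions, joint states *)
Definition jO : finType := {dffun forall i : 'I_N, O i}.
Definition jL : finType := {dffun forall i : 'I_N, L i}.
Definition jA : finType := {dffun forall i : 'I_N, A i}.
Definition jS : finType := (jO * jL)%type.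

Definition sub (c : {set 'I_N}) : finType := {j : 'I_N | j \in c}.
Definition rO (c : {set 'I_N}) : finType := {dffun forall j : sub c, O (val j)}.
Definition rL (c : {set 'I_N}) : finType := {dffun forall j : sub c, L (val j)}.
Definition rA (c : {set 'I_N}) : finType := {dffun forall j : sub c, A (val j)}.

Definition restr (T : 'I_N -> finType) (x : {dffun forall i : 'I_N, T i})
  (c : {set 'I_N}) : {dffun forall j : sub c, T (val j)} :=
  finfun (fun j : sub c => x (val j)).
Arguments restr {T} x c.

Definition Acomm : finType := {c : {set 'I_N} | #|c| == K}.

Context (P : forall i : 'I_N, (O i * L i)%type -> A i -> {ffun (O i * L i)%type -> R}).
Context (sinit : jS) (pact : jS -> {ffun jA -> R}) (pcomm : jO -> {ffun Acomm -> R}).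
Context (Starg Savoid : {set jS}).

Definition Tset : {set jS} := Starg :|: Savoid.

Definition Pj (s : jS) (a : jA) (u : jS) : R :=
  \prod_(i < N) P i (s.1 i, s.2 i) (a i) (u.1 i, u.2 i).

Definition kfull (t : nat) (s : jS) (x : (jA * jS)%type) : R :=
  pact s x.1 * Pj s x.1 x.2.

(* A history of length n is S_0 = sinit followed by an n-tuple of (A_k, S_k). *)
Definition stateAt n (h : n.-tuple (jA * jS)%type) (k : nat) : jS :=
  nth sinit (sinit :: map snd h) k.
Arguments stateAt {n} h k.

(* E_{m-1}: the states at times 0, ..., m-1 all lie outside T *)
Definition Eb n (h : n.-tuple (jA * jS)%type) (m : nat) : bool :=
  [forall k : 'I_m, stateAt h k \notin Tset].
Arguments Eb {n} h m.

(* probability weight of a history under a (time-indexed) kernel;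
   ker t s (a,s') = P(A_t = a, S_t = s' | S_{t-1} = s) *)
Definition pathW (ker : nat -> jS -> (jA * jS)%type -> R) n
  (h : n.-tuple (jA * jS)%type) : R :=
  \prod_(k < n) ker k.+1 (stateAt h k) (tnth h k).
Arguments pathW ker {n} h.

(* P(O_n = o, L^c_n = lc, E_n) in the full-communication process *)
Definition den (n : nat) (c : {set 'I_N}) (o : jO) (lc : rL c) : R :=
  \sum_(h : n.-tuple (jA * jS)%type |
          [&& Eb h n.+1, (stateAt h n).1 == o & restr (stateAt h n).2 c == lc])
    pathW kfull h.

(* P(A^c_{n+1} = ac, O^c_{n+1} = o1c, L^c_{n+1} = l1c, O_n = o, L^c_n = lc, E_n) *)
Definition num (n : nat) (c : {set 'I_N}) (o : jO) (lc : rL c)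
  (x : (rA c * rO c * rL c)%type) : R :=
  \sum_(h : n.+1.-tuple (jA * jS)%type |
          [&& Eb h n.+1, (stateAt h n).1 == o, restr (stateAt h n).2 c == lc,
              restr (tnth h ord_max).1 c == x.1.1,
              restr (tnth h ord_max).2.1 c == x.1.2 &
              restr (tnth h ord_max).2.2 c == x.2])
    pathW kfull h.

(* A family q t c o lc of conditional laws q^c_t( . | o, l^c):
   it is the true conditional probability whenever the conditioning event has
   positive probability, and an arbitrary distribution otherwise. *)
Definition q_family := nat -> forall c : {set 'I_N}, jO -> forall lc : rL c,
  {ffun (rA c * rO c * rL c)%type -> R}.

Definition is_cond_family (q : q_family) : Prop :=
  (forall n c o lc, 0 < den n c o lc ->
     forall x, q n.+1 c o lc x = num n c o lc x / den n c o lc) /\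
  (forall n c o lc, den n c o lc = 0 -> is_dist R _ (q n.+1 c o lc)).

Definition khat (q : q_family) (t : nat) (s : jS) (x : (jA * jS)%type) : R :=
  \sum_(c : Acomm)
     pcomm s.1 c
     * q t (val c) s.1 (restr s.2 (val c))
         (restr x.1 (val c), restr x.2.1 (val c), restr x.2.2 (val c))
     * \prod_(i < N | i \notin val c)
         q t [set i] s.1 (restr s.2 [set i])
           (restr x.1 [set i], restr x.2.1 [set i], restr x.2.2 [set i]).

(* P_X((not S_avoid) U S_target) for the stopped process with kernel ker:
   sum over t of P(S_0,...,S_{t-1} notin T, S_t in S_target). *)
Definition reachP (ker : nat -> jS -> (jA * jS)%type -> R) : \bar R :=
  (\sum_(0 <= n <oo)
     (\sum_(h : n.-tuple (jA * jS)%type | Eb h n && (stateAt h n \in Starg))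
         pathW ker h)%:E)%E.

(* H_{n+1} = H(A_{n+1} S_{n+1} | S_0 A_1 ... S_n) *)
Definition Hent (n : nat) : R :=
  \sum_(h : n.-tuple (jA * jS)%type | Eb h n.+1)
    pathW kfull h * entr R _ (kfull n.+1 (stateAt h n)).

Definition Hsum : \bar R := (\sum_(0 <= n <oo) (Hent n)%:E)%E.

Definition wprime (o : jO) (i : 'I_N) : R :=
  \sum_(c : Acomm | i \notin val c) pcomm o c.

Definition Gi (q : q_family) (i : 'I_N) : \bar R :=
  (\sum_(0 <= n <oo)
     (\sum_(o : jO) \sum_(li : rL [set i])
        wprime o i * den n [set i] o li * entr R _ (q n.+1 [set i] o li))%:E)%E.

Definition Gc (q : q_family) (c : Acomm) : \bar R :=
  (\sum_(0 <= n <oo)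
     (\sum_(o : jO) \sum_(lc : rL (val c))
        pcomm o c * den n (val c) o lc * entr R _ (q n.+1 (val c) o lc))%:E)%E.

Definition Dcost (q : q_family) : \bar R :=
  (\sum_(i < N) Gi q i + \sum_(c : Acomm) Gc q c - Hsum)%E.

End Game.

(* sqrt(1 - exp(-D)), read as 1 when D = +oo (D = -oo cannot occur when
   sum_t H_t < +oo; the value chosen there is immaterial). *)
Definition bound (R : realType) (D : \bar R) : R :=
  match D with
  | EFin r => Num.sqrt (1 - expR (- r))
  | _ => 1
  end.

(* Main.v *)
(** Fix a horizon n and let p and r be the laws of the first n steps of the full-
    and of the restricted-communication process, both continued with the same
    kernel once T is entered. Reaching the target within n steps is an event on
    this finite space, so the Bretagnolle-Huber inequality bounds the difference
    of its probabilities by sqrt (1 - exp (- KL(p, r))). By the chain rule KL(p, r)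
    is a sum of one-step divergences over the times before stopping. Concavity of
    ln, applied to the mixture over the communicating set c, bounds - ln of the
    restricted kernel by a combination of the - ln q^c and - ln q^i, and the law
    of total probability turns their expectations into the entropy terms of
    G^c and G^i. So the n-th step divergence is at most the n-th term of D; these
    terms are nonnegative, hence their partial sums stay below D. *)

Require Import Defs.
From HB Require Import structures.
From mathcomp Require Import all_boot all_order all_algebra.
From mathcomp Require Import all_classical all_reals all_analysis.
From mathcomp Require Import ring lra.
Import Order.TTheory GRing.Theory Num.Theory.
Local Open Scope ring_scope.

(** * Finite sums, Gibbs inequalities and entropy *)

Section FiniteSums.
Context (R : realType).

(** A dependent function amounts to a function into the tagged sum of the [T i] whose value at [i]
    carries the tag [i]; distributivity for ordinary functions then applies. *)
Lemma sum_dffun_prod (I : finType) (T : I -> finType) (F : forall i, T i -> R) :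
  \sum_(f : {dffun forall i, T i}) \prod_i F i (f i)
  = \prod_i \sum_(x : T i) F i x.
Proof.
rewrite (reindex (@dffun_of_fprod I T)); last exact/onW_bij/dffun_of_fprod_bij.
transitivity (\sum_(t : fprod T) \prod_(i in I) [ffun x => F i x] (t i)).
  by apply: eq_bigr => t _; apply: eq_bigr => i _; rewrite !ffunE.
rewrite big_fprod; under [RHS]eq_bigr do rewrite (big_tag F).
rewrite bigA_distr_big_dep; apply: eq_bigr => g /familyP gT.
by apply: eq_bigr => i _; have /eqP e := gT i; rewrite !(untagE _ _ e) ffunE.
Qed.

Lemma ler_sum_inj (X Y : finType) (phi : X -> Y) (F : Y -> R) :
  injective phi -> (forall y, 0 <= F y) -> \sum_x F (phi x) <= \sum_y F y.
Proof.
move=> phiI F0; apply: (@le_trans _ _ (\sum_(y in [set phi x | x in X]) F y)).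
  by rewrite big_imset//= => x y _ _ /phiI.
by rewrite [leRHS](bigID (mem [set phi x | x in X]))/= lerDl sumr_ge0.
Qed.

Lemma sum_fibers (X Y : finType) (Q : pred X) (u : X -> Y) (F : X -> Y -> R) :
  \sum_y \sum_(x | Q x && (u x == y)) F x y = \sum_(x | Q x) F x (u x).
Proof.
rewrite [RHS](partition_big u xpredT)//=; apply: eq_bigr => y _.
by apply: eq_bigr => x /andP[_ /eqP->].
Qed.

Lemma rcons_tuple_bij (T : finType) n :
  bijective (fun hx : n.-tuple T * T => rcons_tuple hx.1 hx.2).
Proof.
apply: inj_card_bij; last by rewrite card_prod !card_tuple expnSr.
move=> [h x] [h' x'] /(congr1 val)/= /rcons_inj[hh' ->].
by congr pair; exact: val_inj.
Qed.

Lemma sum_rcons_tuple (T : finType) n (F : n.+1.-tuple T -> R) :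
  \sum_(h : n.+1.-tuple T) F h
  = \sum_(h : n.-tuple T) \sum_(x : T) F (rcons_tuple h x).
Proof.
rewrite pair_big (reindex (fun hx => rcons_tuple hx.1 hx.2))//=.
exact/onW_bij/rcons_tuple_bij.
Qed.

(** The tangent of [ln] at the mean [M] lies above the graph, [ln (y x) <= ln M + (y x / M - 1)],
    and its linear part averages to zero. Off the support of [p] the weight removes the term,
    whatever [y] is there. *)
Lemma jensen_ln (X : finType) (p y : X -> R) :
  (forall x, 0 <= p x) -> \sum_x p x = 1 -> (forall x, 0 < p x -> 0 < y x) ->
  0 < \sum_x p x * y x /\ \sum_x p x * ln (y x) <= ln (\sum_x p x * y x).
Proof.
move=> p0 p1 y0; set M := \sum_x p x * y x.
have py0 x : 0 <= p x * y x.
  have := p0 x; rewrite le_eqVlt => /predU1P[<-|px]; first by rewrite mul0r.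
  by rewrite mulr_ge0// ltW// y0.
have M0 : 0 < M.
  rewrite lt_neqAle sumr_ge0 // andbT eq_sym; apply/eqP => M0.
  have : \sum_x p x = 0.
    apply: big1 => x _; apply/eqP; have := p0 x.
    rewrite le_eqVlt => /predU1P[<-//|px].
    have /eqP := psumr_eq0P (fun x _ => py0 x) M0 (i := x) isT.
    by rewrite mulf_eq0 (gt_eqF (y0 _ px)) orbF.
  by rewrite p1 => /eqP; rewrite oner_eq0.
split=> //.
have -> : ln M = \sum_x p x * (ln M + (y x / M - 1)).
  under eq_bigr do rewrite mulrDr mulrBr mulr1 mulrA.
  rewrite big_split/= sumrB -!mulr_suml p1 mul1r divff ?gt_eqF//.
  by rewrite subrr addr0.
apply: ler_sum => x _; have := p0 x.
rewrite le_eqVlt => /predU1P[<-|px]; first by rewrite !mul0r.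
rewrite ler_wpM2l// -lerBlDl -ln_div ?posrE ?y0//.
have yM : 0 < y x / M by rewrite divr_gt0// y0.
have := @le_ln1Dx R (y x / M - 1); rewrite addrCA subrr addr0; apply; lra.
Qed.

(** Jensen for the ratio [f / p], whose mean under [p] is the mass of [f] on the support of [p],
    hence at most its total mass. *)
Lemma gibbs_ln (X : finType) (p f : X -> R) :
  (forall x, 0 <= p x) -> \sum_x p x = 1 -> (forall x, 0 <= f x) ->
  (forall x, 0 < p x -> 0 < f x) ->
  0 < \sum_x f x /\ \sum_x p x * (ln (f x) - ln (p x)) <= ln (\sum_x f x).
Proof.
move=> p0 p1 f0 pf.
have [|M0 ML] := @jensen_ln X p (fun x => f x / p x) p0 p1.
  by move=> x px; rewrite divr_gt0// pf.
have MF : \sum_x p x * (f x / p x) <= \sum_x f x.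
  apply: ler_sum => x _; have := p0 x.
  rewrite le_eqVlt => /predU1P[<-|px]; first by rewrite mul0r.
  by rewrite mulrCA divff ?gt_eqF// mulr1.
have F0 := lt_le_trans M0 MF; split=> //.
apply: (@le_trans _ _ (ln (\sum_x p x * (f x / p x)))); last by rewrite ler_ln ?posrE.
apply: le_trans ML; rewrite le_eqVlt; apply/orP; left; apply/eqP.
apply: eq_bigr => x _; have := p0 x.
rewrite le_eqVlt => /predU1P[<-|px]; first by rewrite !mul0r.
by rewrite ln_div ?posrE// pf.
Qed.

(* With f equal to r on B and to p off B, and g the other way round, f g = p r;
   so - KL(p, r) splits into two Gibbs sums, bounded by ln (1 - d) and
   ln (1 + d) with d = p(B) - r(B). *)
Lemma bretagnolle_huber (X : finType) (p r : X -> R) (B : pred X) :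
  (forall x, 0 <= p x) -> \sum_x p x = 1 ->
  (forall x, 0 <= r x) -> \sum_x r x <= 1 -> (forall x, 0 < p x -> 0 < r x) ->
  \sum_(x | B x) p x - \sum_(x | B x) r x
  <= Num.sqrt (1 - expR (- \sum_x p x * (ln (p x) - ln (r x)))).
Proof.
move=> p0 p1 r0 r1 pr.
pose f x := if B x then r x else p x; pose g x := if B x then p x else r x.
have [||F0 FL] := @gibbs_ln X p f p0 p1.
- by move=> x; rewrite /f; case: ifP.
- by move=> x px; rewrite /f; case: ifP => // _; exact: pr.
have [||G0 GL] := @gibbs_ln X p g p0 p1.
- by move=> x; rewrite /g; case: ifP.
- by move=> x px; rewrite /g; case: ifP => // _; exact: pr.
set kl := (X in expR X); set a := \sum_(x | B x) p x; set b := \sum_(x | B x) r x.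
have Fab : \sum_x f x = 1 - (a - b).
  have fB : \sum_(x | B x) f x = b by apply: eq_bigr => x Bx; rewrite /f Bx.
  have fNB : \sum_(x | ~~ B x) f x = \sum_(x | ~~ B x) p x.
    by apply: eq_bigr => x /negbTE Bx; rewrite /f Bx.
  by rewrite -p1 (bigID B)/= [in RHS](bigID B)/= fB fNB -/a; ring.
have Gab : \sum_x g x <= 1 + (a - b).
  suff : \sum_x g x = a + (\sum_x r x - b) by lra.
  have gB : \sum_(x | B x) g x = a by apply: eq_bigr => x Bx; rewrite /g Bx.
  have gNB : \sum_(x | ~~ B x) g x = \sum_(x | ~~ B x) r x.
    by apply: eq_bigr => x /negbTE Bx; rewrite /g Bx.
  by rewrite (bigID B)/= [in RHS](bigID B)/= gB gNB -/b; ring.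
have klE : kl = \sum_x p x * (ln (f x) - ln (p x))
              + \sum_x p x * (ln (g x) - ln (p x)).
  rewrite /kl -sumrN -big_split/=; apply: eq_bigr => x _.
  by rewrite /f /g; case: ifP => _; ring.
have Ekl : expR kl <= (1 - (a - b)) * (1 + (a - b)).
  apply: (@le_trans _ _ ((\sum_x f x) * (\sum_x g x))); last first.
    by rewrite -Fab ler_wpM2l// ltW.
  rewrite -[leRHS]lnK ?posrE ?mulr_gt0// ler_expR lnM ?posrE// klE.
  exact: lerD.
(* With [d = a - b], [Ekl] reads [expR kl <= 1 - d ^+ 2], and [d] is at most the root of its
   square. *)
apply: (le_trans (ler_norm _)); rewrite -sqrtr_sqr ler_wsqrtr//.
by nra.
Qed.

Lemma entr_ge0 (X : finType) (p : X -> R) :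
  (forall x, 0 <= p x) -> \sum_x p x = 1 -> 0 <= entr R X p.
Proof.
move=> p0 p1; rewrite /entr -sumrN; apply: sumr_ge0 => x _.
rewrite /xlnx; case: ifP => _; first by rewrite oppr0.
rewrite -mulrN mulr_ge0// oppr_ge0 ln_le0// -p1 (bigD1 x)//= lerDl.
exact: sumr_ge0.
Qed.

Lemma entrE (X : finType) (p : X -> R) : entr R X p = \sum_x p x * - ln (p x).
Proof.
rewrite /entr -sumrN; apply: eq_bigr => x _; rewrite /xlnx mulrN.
by case: eqP => // ->; rewrite mul0r.
Qed.

Lemma ln_prod (I : finType) (Q : pred I) (F : I -> R) :
  (forall i, Q i -> 0 < F i) ->
  ln (\prod_(i | Q i) F i) = \sum_(i | Q i) ln (F i).
Proof.
move=> F0.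
(* Positivity of the partial products is carried along, since [lnM] asks for it at every factor. *)
suff [] : 0 < \prod_(i | Q i) F i /\
  ln (\prod_(i | Q i) F i) = \sum_(i | Q i) ln (F i) by [].
apply: (big_ind2 (fun x y => 0 < x /\ ln x = y)); first by rewrite ln1.
- by move=> x1 x2 y1 y2 [x10 <-] [y10 <-]; rewrite mulr_gt0// lnM.
- by move=> i Qi; split=> //; exact: F0.
Qed.

End FiniteSums.

(** * Histories, stopping, and the reach event at a fixed horizon *)

Section Histories.
Context (R : realType) (N : nat) (O L A : 'I_N -> finType).
Context (sinit : jS N O L) (Starg Savoid : {set jS N O L}).

Local Notation X := (jA N A * jS N O L)%type.
Local Notation sAt := (stateAt N O L A sinit _).
Local Notation alive := (Eb N O L A sinit Starg Savoid _).
Local Notation pathW := (pathW R N O L A sinit).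
Local Notation kernel := (nat -> jS N O L -> X -> R).

Lemma stateAt_rcons n (h : n.-tuple X) x k :
  (k <= n)%N -> sAt (rcons_tuple h x) k = sAt h k.
Proof.
move=> kn; rewrite /stateAt /= map_rcons -rcons_cons nth_rcons /=.
by rewrite size_map size_tuple ltnS kn.
Qed.

Lemma tnth_rcons_max n (h : n.-tuple X) x : tnth (rcons_tuple h x) ord_max = x.
Proof. by rewrite (tnth_nth x)/= nth_rcons size_tuple ltnn eqxx. Qed.

Lemma EbP n (h : n.-tuple X) m :
  reflect (forall k, (k < m)%N -> sAt h k \notin Tset N O L Starg Savoid)
          (alive h m).
Proof.
apply: (iffP forallP) => [H k km|H k]; last exact: H.
exact: (H (Ordinal km)).
Qed.

(** [alive h m] inspects only states of index below [m], and the appended state has index [n.+1]. *)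
Lemma Eb_rcons n (h : n.-tuple X) x m :
  (m <= n.+1)%N -> alive (rcons_tuple h x) m = alive h m.
Proof.
move=> mn; apply: eq_forallb => k; rewrite stateAt_rcons//.
by rewrite -ltnS (leq_trans (ltn_ord k)).
Qed.

Lemma Eb_le n (h : n.-tuple X) m m' : (m' <= m)%N -> alive h m -> alive h m'.
Proof. by move=> mm /EbP H; apply/EbP => k km; apply/H/(leq_trans km). Qed.

(* The weight of a history driven by k2 until it enters T and by k1 from then
   on. Replacing the kernel after the stopping time by a common one gives laws
   on the full space of histories of a fixed length. *)
Definition switchW (k1 k2 : kernel) n (h : n.-tuple X) : R :=
  \prod_(k < n) (if alive h k.+1 then k2 else k1) k.+1 (sAt h k) (tnth h k).
Arguments switchW k1 k2 {n} h.

Lemma switchW_rcons k1 k2 n (h : n.-tuple X) x :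
  switchW k1 k2 (rcons_tuple h x)
  = switchW k1 k2 h * (if alive h n.+1 then k2 else k1) n.+1 (sAt h n) x.
Proof.
rewrite /switchW big_ord_recr/= Eb_rcons// stateAt_rcons// tnth_rcons_max.
congr (_ * _); apply: eq_bigr => k _; rewrite Eb_rcons ?ltnS 1?ltnW//.
rewrite stateAt_rcons 1?ltnW// (_ : tnth (rcons_tuple h x) _ = tnth h k)//.
by rewrite !(tnth_nth x)/= nth_rcons size_tuple ltn_ord.
Qed.

Lemma switchWxx k n (h : n.-tuple X) : switchW k k h = pathW k n h.
Proof. by apply: eq_bigr => i _; rewrite if_same. Qed.

Lemma switchW_alive k1 k2 n (h : n.-tuple X) :
  alive h n -> switchW k1 k2 h = pathW k2 n h.
Proof.
by move=> hn; apply: eq_bigr => i _; rewrite (Eb_le _ _ _ _ _ hn).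
Qed.

Lemma pathW_rcons k n (h : n.-tuple X) x :
  pathW k n.+1 (rcons_tuple h x) = pathW k n h * k n.+1 (sAt h n) x.
Proof. by rewrite -!switchWxx switchW_rcons if_same. Qed.

Lemma pathW_ge0 (k : kernel) n (h : n.-tuple X) :
  (forall t s x, 0 <= k t.+1 s x) -> 0 <= pathW k n h.
Proof. by move=> k0; apply: prodr_ge0. Qed.

Lemma sum_pathW (k : kernel) n : (forall t s, \sum_x k t.+1 s x = 1) ->
  \sum_h pathW k n h = 1.
Proof.
move=> k1; elim: n => [|n IH].
  rewrite (eq_bigr (fun=> 1)) => [|h _]; last by rewrite /Defs.pathW big_ord0.
  by rewrite sumr_const card_tuple expn0.
rewrite sum_rcons_tuple -IH; apply: eq_bigr => h _.
by under eq_bigr do rewrite pathW_rcons; rewrite -mulr_sumr k1 mulr1.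
Qed.

(** The reach event on histories of one fixed length. It ignores everything after the first entry
    into T, so the kernel used from then on does not affect its probability. *)
Definition reached n (h : n.-tuple X) : bool :=
  [exists k : 'I_n.+1, alive h k && (sAt h k \in Starg)].
Arguments reached {n} h.

Lemma reached_rcons n (h : n.-tuple X) x : reached (rcons_tuple h x) =
  reached h || (alive (rcons_tuple h x) n.+1 &&
    (sAt (rcons_tuple h x) n.+1 \in Starg)).
Proof.
apply/existsP/orP => [[k /andP[ak sk]]|[/existsP[k /andP[ak sk]]|H]].
- have [kn|kn] := ltnP k n.+1; [left|right].
    apply/existsP; exists (Ordinal kn) => /=.
    by rewrite Eb_rcons 1?ltnW// in ak; rewrite stateAt_rcons// in sk; rewrite ak.
  have e : k = n.+1 :> nat by apply/eqP; rewrite eqn_leq kn -ltnS ltn_ord.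
  by rewrite e in ak sk; rewrite ak.
- exists (widen_ord (leqnSn _) k) => /=.
  have kn : (k <= n)%N by rewrite -ltnS.
  by rewrite Eb_rcons 1?ltnW// stateAt_rcons// ak.
- by exists ord_max.
Qed.

Lemma reached_dead n (h : n.-tuple X) : reached h -> ~~ alive h n.+1.
Proof.
move=> /existsP[k /andP[_ sk]]; apply/EbP => /(_ k (ltn_ord k)).
by rewrite /Tset inE sk.
Qed.

Definition reachN (k : kernel) n : R :=
  \sum_(h : n.-tuple X | alive h n && (sAt h n \in Starg)) pathW k n h.

(** Induction on the horizon. A history that has already reached the target continues with [k1], of
    mass 1, so its weight is kept; one that reaches it just now has been driven by [k2] throughout
    and contributes to the new term. *)
Lemma sum_switchW_reached (k1 k2 : kernel) n :
  (forall t s, \sum_x k1 t.+1 s x = 1) ->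
  \sum_(h : n.-tuple X | reached h) switchW k1 k2 h = \sum_(m < n.+1) reachN k2 m.
Proof.
move=> k11; elim: n => [|n IH].
  rewrite big_ord1; apply: eq_big => [h|h _].
    apply/existsP/idP => [[k]|]; first by rewrite (ord1 k).
    by exists ord0.
  by rewrite /switchW /Defs.pathW !big_ord0.
rewrite big_ord_recr/= -IH big_mkcond sum_rcons_tuple.
rewrite [X in _ = X + _]big_mkcond [X in _ = _ + X]big_mkcond sum_rcons_tuple.
rewrite -big_split/=; apply: eq_bigr => h _.
have [rh|rh] := boolP (reached h).
  have /negbTE dh := reached_dead _ _ rh.
  rewrite [X in _ + X]big1 => [|x _]; last by rewrite Eb_rcons// dh.
  rewrite addr0 -[RHS]mulr1 -(k11 n (sAt h n)) mulr_sumr.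
  by apply: eq_bigr => x _; rewrite reached_rcons rh switchW_rcons dh.
rewrite add0r; apply: eq_bigr => x _; rewrite reached_rcons (negbTE rh)/=.
by case: ifP => // /andP[/(switchW_alive k1 k2)->].
Qed.

(** * Chain rule for the divergence of two stopped processes *)

Section Gap.
Context (k1 k2 : kernel)
  (k1_ge0 : forall t s x, 0 <= k1 t.+1 s x)
  (k1_sum : forall t s, \sum_x k1 t.+1 s x = 1)
  (k2_ge0 : forall t s x, 0 <= k2 t.+1 s x)
  (k2_sum : forall t s, \sum_x k2 t.+1 s x <= 1)
  (k1_abscont : forall n (h : n.-tuple X) x, alive h n.+1 ->
    0 < pathW k1 n h -> 0 < k1 n.+1 (sAt h n) x -> 0 < k2 n.+1 (sAt h n) x).

(** The conditional relative entropy of step [n.+1] given the history. Terms with [k1] zero vanish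
    by their weight; where both the history weight and [k1] are positive, [k1_abscont] makes [k2]
    positive too. *)
Definition stepKL n : R := \sum_(h : n.-tuple X | alive h n.+1)
  pathW k1 n h * \sum_x k1 n.+1 (sAt h n) x
    * (ln (k1 n.+1 (sAt h n) x) - ln (k2 n.+1 (sAt h n) x)).

Lemma stepKL_ge0 n : 0 <= stepKL n.
Proof.
apply: sumr_ge0 => h ah; have := pathW_ge0 k1 n h k1_ge0.
rewrite le_eqVlt => /predU1P[<-|ph]; first by rewrite mul0r.
apply: mulr_ge0; first exact: ltW.
rewrite -oppr_le0 -sumrN.
have [_ +] := @gibbs_ln R _ (k1 n.+1 (sAt h n)) (k2 n.+1 (sAt h n))
  (k1_ge0 _ _) (k1_sum _ _) (k2_ge0 _ _) (fun x => k1_abscont n h x ah ph).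
move=> /le_trans/(_ (ln_le0 (k2_sum _ _))); apply: le_trans.
by apply: ler_sum => x _; rewrite -mulrN opprB.
Qed.

Lemma switchW_ge0 n (h : n.-tuple X) : 0 <= switchW k1 k2 h.
Proof. by apply: prodr_ge0 => i _; case: ifP. Qed.

Lemma sum_switchW n : \sum_(h : n.-tuple X) switchW k1 k2 h <= 1.
Proof.
elim: n => [|n IH].
  rewrite (eq_bigr (fun=> 1)) => [|h _]; last by rewrite /switchW big_ord0.
  by rewrite sumr_const card_tuple expn0.
rewrite sum_rcons_tuple; apply: le_trans IH; apply: ler_sum => h _.
under eq_bigr do rewrite switchW_rcons.
by rewrite -mulr_sumr ler_piMr ?switchW_ge0//; case: ifP => //; rewrite k1_sum.
Qed.

Lemma switchW_gt0 n (h : n.-tuple X) : 0 < pathW k1 n h -> 0 < switchW k1 k2 h.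
Proof.
elim: n h => [|n IH] h; first by rewrite /switchW big_ord0.
have [g _ gK] := rcons_tuple_bij X n.
rewrite -(gK h); move: (g h) => [{}h x] /=; rewrite pathW_rcons switchW_rcons => p0.
have h0 : 0 < pathW k1 n h.
  rewrite lt_neqAle pathW_ge0// andbT; apply: contraTneq p0 => <-.
  by rewrite mul0r ltxx.
move: p0; rewrite pmulr_rgt0// => x0; rewrite mulr_gt0 ?IH//.
by case: ifPn => // ah; exact: k1_abscont.
Qed.

(** Splitting off the last step, the log-ratio of the weights is that of the first [n] steps,
    constant in the last move, plus that of the last move. The latter is zero once the history is
    stopped, because both laws then use [k1]. *)
Lemma KL_chain n :
  \sum_h pathW k1 n h * (ln (pathW k1 n h) - ln (switchW k1 k2 h))
  = \sum_(m < n) stepKL m.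
Proof.
elim: n => [|n IH].
  rewrite big_ord0 big1// => h _.
  by rewrite /switchW /Defs.pathW !big_ord0 subrr mulr0.
rewrite big_ord_recr/= -IH sum_rcons_tuple /stepKL [X in _ + X]big_mkcond.
rewrite -big_split/=; apply: eq_bigr => h _.
have := pathW_ge0 k1 n h k1_ge0; rewrite le_eqVlt => /predU1P[p0|p0].
  rewrite -p0 !mul0r if_same addr0; apply: big1 => x _.
  by rewrite pathW_rcons -p0 !mul0r.
have r0 := switchW_gt0 n h p0.
transitivity (pathW k1 n h * \sum_x (k1 n.+1 (sAt h n) x
    * (ln (pathW k1 n h) - ln (switchW k1 k2 h))
  + if alive h n.+1 then k1 n.+1 (sAt h n) x
    * (ln (k1 n.+1 (sAt h n) x) - ln (k2 n.+1 (sAt h n) x)) else 0)).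
  rewrite mulr_sumr; apply: eq_bigr => x _; rewrite pathW_rcons switchW_rcons -mulrA.
  have := k1_ge0 n (sAt h n) x; rewrite le_eqVlt => /predU1P[<-|x0].
    by rewrite !mul0r if_same addr0.
  rewrite [ln (pathW k1 n h * _)]lnM ?posrE//; case: ifPn => ah.
    rewrite lnM ?posrE//; last exact: k1_abscont.
    by ring.
  by rewrite lnM ?posrE//; ring.
rewrite big_split/= mulrDr -mulr_suml k1_sum mul1r; congr (_ + _).
by case: ifP => // _; rewrite big1 ?mulr0.
Qed.

(** Entry times 0 to [n] are decided by [n] steps, hence [n.+1] reach terms against [n] divergences.
    Both sums are probabilities of [reached], under [switchW k1 k1] and [switchW k1 k2]. *)
Lemma reach_gap n :
  \sum_(m < n.+1) reachN k1 m - \sum_(m < n.+1) reachN k2 m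
  <= Num.sqrt (1 - expR (- \sum_(m < n) stepKL m)).
Proof.
rewrite -(sum_switchW_reached k1 k1)// -(sum_switchW_reached k1 k2)//.
under eq_bigr do rewrite switchWxx.
rewrite -KL_chain; apply: bretagnolle_huber => [h||h||h].
- exact: pathW_ge0.
- exact: sum_pathW.
- exact: switchW_ge0.
- exact: sum_switchW.
- exact: switchW_gt0.
Qed.

Lemma sum_reachN_le1 n : \sum_(m < n) reachN k2 m <= 1.
Proof.
apply: (@le_trans _ _ (\sum_(m < n.+1) reachN k2 m)).
  rewrite big_ord_recr/= lerDl; apply: sumr_ge0 => h _; exact: pathW_ge0.
rewrite -(sum_switchW_reached k1 k2)//; apply: le_trans (sum_switchW n).
rewrite [leRHS](bigID (@reached n))/= lerDl.
by apply: sumr_ge0 => h _; exact: switchW_ge0.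
Qed.

End Gap.
End Histories.

(** * Restricting joint moves to groups of agents *)

Section Restrictions.
Context (R : realType) (N : nat) (O L A : 'I_N -> finType).
Local Notation X := (jA N A * jS N O L)%type.
Local Notation rX c := (rA N A c * rO N O c * rL N L c)%type.

Definition restrX (c : {set 'I_N}) (x : X) : rX c :=
  (restr N A x.1 c, restr N O x.2.1 c, restr N L x.2.2 c).

Lemma restr_inj (T : 'I_N -> finType) (c : {set 'I_N})
    (x y : {dffun forall i, T i}) i :
  restr N T x c = restr N T y c -> i \in c -> x i = y i.
Proof.
move=> /ffunP xy ic; have := xy (exist _ i ic); rewrite /restr !ffunE.
exact.
Qed.

Lemma restrX_inj (c : {set 'I_N}) (x y : X) i :
  restrX c x = restrX c y -> i \in c ->
  [/\ x.1 i = y.1 i, x.2.1 i = y.2.1 i & x.2.2 i = y.2.2 i].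
Proof.
by move=> [ea eo el] ic; split;
  [exact: (restr_inj _ _ _ _ _ ea)|exact: (restr_inj _ _ _ _ _ eo)
  |exact: (restr_inj _ _ _ _ _ el)].
Qed.

(** A joint move is determined by its restriction to [c] and its single-agent restrictions outside
    [c]. This embeds the moves in a product type, over which the sum factors. An inequality is
    enough, as the second law in the Bretagnolle-Huber bound may have mass below 1. *)
Lemma sum_restrX_prod_le (c : {set 'I_N}) (f : rX c -> R)
    (g : forall i, rX [set i] -> R) :
  (forall y, 0 <= f y) -> (forall i y, 0 <= g i y) ->
  \sum_(x : X) f (restrX c x) * \prod_(i < N | i \notin c) g i (restrX [set i] x)
  <= (\sum_y f y) * \prod_(i < N | i \notin c) \sum_y g i y.
Proof.
move=> f0 g0; pose I' : finType := {i : 'I_N | i \notin c}.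
pose D : finType := {dffun forall j : I', rX [set val j]}.
have prodE (F : 'I_N -> R) :
    \prod_(i < N | i \notin c) F i = \prod_(j : I') F (val j).
  by rewrite (big_sub (fun i => i \notin c)).
rewrite prodE -(sum_dffun_prod _ _ _ (fun j : I' => g (val j))) mulr_suml.
under [leRHS]eq_bigr do rewrite mulr_sumr.
rewrite pair_big/=.
pose phi (x : X) : rX c * D :=
  (restrX c x, finfun (fun j : I' => restrX [set val j] x)).
pose F (y : rX c * D) := f y.1 * \prod_(j : I') g (val j) (y.2 j).
have -> : \sum_(x : X) f (restrX c x) * \prod_(i < N | i \notin c)
    g i (restrX [set i] x) = \sum_x F (phi x).
  apply: eq_bigr => x _; rewrite /F /=; congr (_ * _).
  by rewrite prodE; apply: eq_bigr => j _; rewrite ffunE.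
apply: ler_sum_inj => [x y|y]; last first.
  by rewrite mulr_ge0//; apply: prodr_ge0.
move=> E; have exy : restrX c x = restrX c y := congr1 fst E.
have /ffunP exy' : (phi x).2 = (phi y).2 := congr1 snd E.
have xy i : [/\ x.1 i = y.1 i, x.2.1 i = y.2.1 i & x.2.2 i = y.2.2 i].
  have [ic|ic] := boolP (i \in c).
    exact: restrX_inj exy ic.
  have := exy' (exist _ i ic); rewrite !ffunE/= => /restrX_inj; apply.
  exact/set11.
move: x y xy {E exy exy'} => [xa [xo xl]] [ya [yo yl]] /= xy.
by congr (_, (_, _)); apply/ffunP => i; have [] := xy i.
Qed.

End Restrictions.

(** * The full-communication kernel and its conditional laws *)

Section Game.
Context (R : realType) (N : nat) (O L A : 'I_N -> finType) (K : nat)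
  (P : forall i : 'I_N, (O i * L i)%type -> A i -> {ffun (O i * L i)%type -> R})
  (sinit : jS N O L)
  (pcomm : jO N O -> {ffun Acomm N K -> R})
  (pact : jS N O L -> {ffun jA N A -> R})
  (Starg Savoid : {set jS N O L})
  (q : q_family R N O L A)
  (P_dist : forall i s a, is_dist R _ (P i s a))
  (pcomm_dist : forall o, is_dist R _ (pcomm o))
  (pact_dist : forall s, is_dist R _ (pact s))
  (q_cond : is_cond_family R N O L A P sinit pact Starg Savoid q).

Local Notation X := (jA N A * jS N O L)%type.
Local Notation sAt := (stateAt N O L A sinit _).
Local Notation alive := (Eb N O L A sinit Starg Savoid _).
Local Notation kf := (kfull R N O L A P pact).
Local Notation kh := (khat R N O L A K pcomm q).
Local Notation W := (pathW R N O L A sinit kf).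
Local Notation den := (Defs.den R N O L A P sinit pact Starg Savoid).
Local Notation num := (Defs.num R N O L A P sinit pact Starg Savoid).
Local Notation rx := (restrX N O L A).
Local Notation rl s c := (restr N L (s : jS N O L).2 c).

Lemma kfull_ge0 t s x : 0 <= kf t s x.
Proof.
rewrite mulr_ge0 ?(proj1 (pact_dist s))//; apply: prodr_ge0 => i _.
exact: (proj1 (P_dist _ _ _)).
Qed.

(** The sums over local parts and then over public parts move inside the product over agents,
    leaving the mass of one local transition law per agent. *)
Lemma sum_kfull t s : \sum_x kf t s x = 1.
Proof.
rewrite -(proj2 (pact_dist s)).
rewrite -(pair_bigA _ (fun a u => pact s a * Pj R N O L A P s a u))/=.
apply: eq_bigr => a _; rewrite -mulr_sumr -[RHS]mulr1; congr (_ * _).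
rewrite -(pair_bigA _ (fun o l => Pj R N O L A P s a (o, l)))/= /Pj/=.
under eq_bigr => o _ do
  rewrite (sum_dffun_prod R _ _ (fun i l => P i (s.1 i, s.2 i) (a i) (o i, l))).
rewrite (sum_dffun_prod R _ _
  (fun i o => \sum_l P i (s.1 i, s.2 i) (a i) (o, l))).
apply: big1 => i _; rewrite -(proj2 (P_dist i (s.1 i, s.2 i) (a i))).
by rewrite pair_bigA; apply: eq_bigr => -[].
Qed.

Lemma fullW_ge0 n (h : n.-tuple X) : 0 <= W n h.
Proof. by apply: pathW_ge0 => *; exact: kfull_ge0. Qed.

(** The conditioning event is decided by the first [n] steps, so the last step can be summed
    separately. *)
Lemma numE n c o lc y : num n c o lc y =
  \sum_(h : n.-tuple X | [&& alive h n.+1, (sAt h n).1 == o & rl (sAt h n) c == lc])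
    W n h * \sum_(x | rx c x == y) kf n.+1 (sAt h n) x.
Proof.
rewrite /Defs.num big_mkcond sum_rcons_tuple [RHS]big_mkcond.
apply: eq_bigr => h _; case: ifPn => [/and3P[h1 h2 h3]|hN].
  rewrite mulr_sumr [RHS]big_mkcond; apply: eq_bigr => x _.
  rewrite Eb_rcons// stateAt_rcons// tnth_rcons_max h1 h2 h3.
  rewrite (pathW_rcons _ _ _ _ _ _ Starg Savoid).
  by case: y => -[ya yo] yl; rewrite /restrX !xpair_eqE -andbA.
apply: big1 => x _; rewrite Eb_rcons// stateAt_rcons//.
by rewrite !andbA -(andbA (alive _ _)) (negbTE hN).
Qed.

Lemma den_ge0 n c o lc : 0 <= den n c o lc.
Proof. by apply: sumr_ge0 => h _; exact: fullW_ge0. Qed.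

Lemma num_ge0 n c o lc y : 0 <= num n c o lc y.
Proof.
rewrite numE; apply: sumr_ge0 => h _; rewrite mulr_ge0 ?fullW_ge0//.
by apply: sumr_ge0 => x _; exact: kfull_ge0.
Qed.

Lemma sum_num n c o lc : \sum_y num n c o lc y = den n c o lc.
Proof.
under eq_bigr do rewrite numE; rewrite exchange_big/=; apply: eq_bigr => h _.
rewrite -mulr_sumr (sum_fibers _ _ _ xpredT (rx c) (fun x _ => kf n.+1 (sAt h n) x)).
by rewrite sum_kfull mulr1.
Qed.

(** The multiplied form also covers [den = 0]: the nonnegative [num] sum to [den], so all vanish,
    whatever law [q] is there. *)
Lemma den_q n c o lc y : den n c o lc * q n.+1 c o lc y = num n c o lc y.
Proof.
have := den_ge0 n c o lc; rewrite le_eqVlt => /predU1P[d0|d0]; last first.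
  by rewrite (proj1 q_cond)// mulrCA divff ?mulr1// gt_eqF.
rewrite -d0 mul0r; apply/esym.
have s0 : \sum_y num n c o lc y = 0 by rewrite sum_num.
exact: psumr_eq0P (fun y _ => num_ge0 n c o lc y) s0 y isT.
Qed.

Lemma q_ge0 n c o lc y : 0 <= q n.+1 c o lc y.
Proof.
have := den_ge0 n c o lc; rewrite le_eqVlt => /predU1P[d0|d0]; last first.
  by rewrite (proj1 q_cond)// divr_ge0 ?num_ge0 ?den_ge0.
exact: (proj1 (proj2 q_cond _ _ _ _ (esym d0))).
Qed.

Lemma sum_q n c o lc : \sum_y q n.+1 c o lc y = 1.
Proof.
have := den_ge0 n c o lc; rewrite le_eqVlt => /predU1P[d0|d0].
  exact: (proj2 (proj2 q_cond _ _ _ _ (esym d0))).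
under eq_bigr do rewrite (proj1 q_cond)//.
by rewrite -mulr_suml sum_num divff// gt_eqF.
Qed.

(** The history [h] followed by [x] already contributes a positive term to [num]. Absolute
    continuity of the full law with respect to the restricted one rests on this. *)
Lemma q_gt0 n (h : n.-tuple X) c x : alive h n.+1 -> 0 < W n h ->
  0 < kf n.+1 (sAt h n) x ->
  0 < q n.+1 c (sAt h n).1 (rl (sAt h n) c) (rx c x).
Proof.
move=> ah h0 x0; set o := _.1; set lc := rl _ _.
suff n0 : 0 < num n c o lc (rx c x).
  rewrite lt_neqAle q_ge0 andbT; apply: contraTneq n0 => q0.
  by rewrite -den_q -q0 mulr0 ltxx.
rewrite numE (bigD1 h)/=; last by rewrite ah !eqxx.
rewrite ltr_pwDl//; last first.
  apply: sumr_ge0 => h' _; rewrite mulr_ge0 ?fullW_ge0//.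
  by apply: sumr_ge0 => y _; exact: kfull_ge0.
rewrite mulr_gt0// (bigD1 x)//= ltr_pwDl//.
by apply: sumr_ge0 => y _; exact: kfull_ge0.
Qed.

(** The integrand sees the history only through [o] and [lc], and the move only through its
    restriction to [c]. Given [o] and [lc] that restriction has law [q] itself, so the cross-entropy
    is an entropy. *)
Lemma cross_entropyE n c (w : jO N O -> R) :
  \sum_(h : n.-tuple X | alive h n.+1) W n h * \sum_x kf n.+1 (sAt h n) x
    * (w (sAt h n).1 * - ln (q n.+1 c (sAt h n).1 (rl (sAt h n) c) (rx c x)))
  = \sum_o \sum_lc w o * den n c o lc * entr R _ (q n.+1 c o lc).
Proof.
pose F (h : n.-tuple X) o lc := W n h * \sum_x kf n.+1 (sAt h n) x
    * (w o * - ln (q n.+1 c o lc (rx c x))).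
transitivity (\sum_o \sum_lc \sum_(h : n.-tuple X |
    (alive h n.+1 && ((sAt h n).1 == o)) && (rl (sAt h n) c == lc)) F h o lc).
  under [RHS]eq_bigr => o _ do
    rewrite (sum_fibers _ _ _ _ (fun h => rl (sAt h n) c) (fun h lc => F h o lc)).
  by rewrite (sum_fibers _ _ _ _ (fun h => (sAt h n).1)
    (fun h o => F h o (rl (sAt h n) c))).
apply: eq_bigr => o _; apply: eq_bigr => lc _.
rewrite entrE -mulrA mulr_sumr.
(* Replacing [den * q] by [num] turns the average under [q] back into a sum over histories and last
   moves. *)
under [in RHS]eq_bigr => y _ do rewrite mulrA den_q numE mulr_suml.
rewrite exchange_big mulr_sumr/=; apply: eq_big => [h|h _]; first by rewrite andbA.
rewrite /F; under [in RHS]eq_bigr => y _ do rewrite -mulrA mulr_suml.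
rewrite -mulr_sumr mulrCA; congr (_ * _); rewrite mulr_sumr.
under [in RHS]eq_bigr => y _ do rewrite mulr_sumr.
rewrite (sum_fibers _ _ _ xpredT (rx c)
  (fun x y => w o * (kf n.+1 (sAt h n) x * - ln (q n.+1 c o lc y)))).
by apply: eq_bigr => x _; rewrite mulrCA.
Qed.

(** * The restricted kernel as a mixture over communicating groups *)

Definition indepQ n (s : jS N O L) (c : Acomm N K) (x : X) : R :=
  q n.+1 (val c) s.1 (rl s (val c)) (rx (val c) x)
  * \prod_(i < N | i \notin val c) q n.+1 [set i] s.1 (rl s [set i]) (rx [set i] x).

Lemma khatE n s x : kh n.+1 s x = \sum_c pcomm s.1 c * indepQ n s c x.
Proof. by apply: eq_bigr => c _; rewrite /indepQ mulrA. Qed.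

Lemma pcomm_ge0 o c : 0 <= pcomm o c.
Proof. exact: (proj1 (pcomm_dist o)). Qed.

Lemma wprime_ge0 o i : 0 <= wprime R N O K pcomm o i.
Proof. by apply: sumr_ge0 => c _; exact: pcomm_ge0. Qed.

Lemma indepQ_ge0 n s c x : 0 <= indepQ n s c x.
Proof.
by rewrite mulr_ge0 ?q_ge0//; apply: prodr_ge0 => i _; exact: q_ge0.
Qed.

Lemma khat_ge0 n s x : 0 <= kh n.+1 s x.
Proof.
rewrite khatE; apply: sumr_ge0 => c _.
by rewrite mulr_ge0 ?pcomm_ge0 ?indepQ_ge0.
Qed.

Lemma sum_khat_le1 n s : \sum_x kh n.+1 s x <= 1.
Proof.
under eq_bigr do rewrite khatE.
rewrite exchange_big/= -(proj2 (pcomm_dist s.1)); apply: ler_sum => c _.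
rewrite -mulr_sumr ler_piMr ?pcomm_ge0//.
apply: le_trans (sum_restrX_prod_le R N O L A (val c)
  (q n.+1 (val c) s.1 (rl s (val c)))
  (fun i => q n.+1 [set i] s.1 (rl s [set i])) _ _) _ => [y|i y|].
- exact: q_ge0.
- exact: q_ge0.
- by rewrite sum_q big1 ?mulr1// => i _; rewrite sum_q.
Qed.

Lemma indepQ_gt0 n (h : n.-tuple X) c x : alive h n.+1 -> 0 < W n h ->
  0 < kf n.+1 (sAt h n) x -> 0 < indepQ n (sAt h n) c x.
Proof.
move=> ah h0 x0; rewrite mulr_gt0 ?q_gt0//.
by apply: prodr_gt0 => i _; exact: q_gt0.
Qed.

Lemma khat_gt0 n (h : n.-tuple X) x : alive h n.+1 -> 0 < W n h ->
  0 < kf n.+1 (sAt h n) x -> 0 < kh n.+1 (sAt h n) x.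
Proof.
move=> ah h0 x0; rewrite khatE.
by have [] := @jensen_ln R _ (pcomm (sAt h n).1)
  (fun c => indepQ n (sAt h n) c x) (pcomm_ge0 _) (proj2 (pcomm_dist _))
  (fun c _ => indepQ_gt0 n h c x ah h0 x0).
Qed.

(** Jensen over the drawn group [c]; the logarithm of each component splits into a term for [c] and
    one for each agent outside it. Collected over [c], agent [i] gets the weight [wprime]. *)
Lemma ln_khat_ge n (h : n.-tuple X) x (s := sAt h n) :
  alive h n.+1 -> 0 < W n h -> 0 < kf n.+1 s x ->
  - ln (kh n.+1 s x)
  <= \sum_(i < N) wprime R N O K pcomm s.1 i
       * - ln (q n.+1 [set i] s.1 (rl s [set i]) (rx [set i] x))
   + \sum_c pcomm s.1 c * - ln (q n.+1 (val c) s.1 (rl s (val c)) (rx (val c) x)).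
Proof.
move=> ah h0 x0.
have [_ J] := @jensen_ln R _ (pcomm s.1)
  (fun c => indepQ n s c x) (pcomm_ge0 _) (proj2 (pcomm_dist _))
  (fun c _ => indepQ_gt0 n h c x ah h0 x0).
rewrite khatE; move: J; rewrite -lerN2 => /le_trans; apply.
rewrite -sumrN /wprime.
(* Unfolding [wprime] allows the sums over agents and groups to be exchanged, so that both sides are
   compared group by group. *)
under [X in _ <= X + _]eq_bigr => i _ do rewrite mulr_suml big_mkcond/=.
rewrite exchange_big -big_split/=; apply: ler_sum => c _.
rewrite /indepQ lnM ?posrE ?q_gt0//; last first.
  by apply: prodr_gt0 => i _; exact: q_gt0.
rewrite ln_prod => [|i _]; last exact: q_gt0.
rewrite -big_mkcond/= -mulr_sumr -mulrN -mulrDr opprD -sumrN addrC//.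
Qed.

(** * The cost of one step and the series for D *)

Definition agentTerm n i : R := \sum_o \sum_(li : rL N L [set i])
  wprime R N O K pcomm o i * den n [set i] o li * entr R _ (q n.+1 [set i] o li).
Definition groupTerm n (c : Acomm N K) : R := \sum_o \sum_(lc : rL N L (val c))
  pcomm o c * den n (val c) o lc * entr R _ (q n.+1 (val c) o lc).
Local Notation Hent := (Hent R N O L A P sinit pact Starg Savoid).
Definition costTerm n : R :=
  \sum_(i < N) agentTerm n i + \sum_c groupTerm n c - Hent n.

(** [cross_entropyE] rewrites the entropy terms of agents and groups as sums over live histories and
    moves. The entropy [Hent] supplies the [ln] of the full kernel, and [ln_khat_ge] compares the
    rest pointwise. *)
Lemma stepKL_le n :
  stepKL R N O L A sinit Starg Savoid kf kh n <= costTerm n.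
Proof.
rewrite /costTerm /agentTerm /groupTerm.
under eq_bigr do rewrite -cross_entropyE.
under [X in _ + X - _]eq_bigr => c _ do rewrite -cross_entropyE.
rewrite exchange_big [X in _ + X - _]exchange_big -big_split/= /Defs.Hent -sumrB.
apply: ler_sum => h ah; have := fullW_ge0 n h.
rewrite le_eqVlt => /predU1P[<-|h0].
  by rewrite !mul0r !big1 ?addr0 ?subr0// => *; rewrite mul0r.
rewrite -!mulr_sumr -mulrDr -mulrBr.
apply: ler_wpM2l; first exact: ltW.
rewrite exchange_big [X in _ + X - _]exchange_big -big_split/= entrE -sumrB.
apply: ler_sum => x _; rewrite -!mulr_sumr -mulrDr -mulrBr.
have := kfull_ge0 n.+1 (sAt h n) x; rewrite le_eqVlt => /predU1P[<-|x0].
  by rewrite !mul0r.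
apply: ler_wpM2l; first exact: ltW.
rewrite opprK addrC lerD2r.
exact: ln_khat_ge.
Qed.

(** This difference of entropies is nonnegative because it dominates a divergence; the partial sums
    of the cost are thus monotone. *)
Lemma costTerm_ge0 n : 0 <= costTerm n.
Proof.
apply: le_trans (stepKL_le n); apply: stepKL_ge0 => *.
- exact: kfull_ge0.
- exact: sum_kfull.
- exact: khat_ge0.
- exact: sum_khat_le1.
- exact: khat_gt0.
Qed.

Lemma agentTerm_ge0 n i : 0 <= agentTerm n i.
Proof.
apply: sumr_ge0 => o _; apply: sumr_ge0 => li _.
rewrite mulr_ge0 ?mulr_ge0 ?wprime_ge0 ?den_ge0// entr_ge0//.
  by move=> y; exact: q_ge0.
exact: sum_q.
Qed.

Lemma groupTerm_ge0 n c : 0 <= groupTerm n c.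
Proof.
apply: sumr_ge0 => o _; apply: sumr_ge0 => lc _.
rewrite mulr_ge0 ?mulr_ge0 ?pcomm_ge0 ?den_ge0// entr_ge0//.
  by move=> y; exact: q_ge0.
exact: sum_q.
Qed.

Lemma Hent_ge0 n : 0 <= Hent n.
Proof.
apply: sumr_ge0 => h _; rewrite mulr_ge0 ?fullW_ge0// entr_ge0//.
  by move=> y; exact: kfull_ge0.
exact: sum_kfull.
Qed.

(** Since [Hsum] is finite it can be added to both sides; what remains is an identity between
    nonnegative series, which may be added termwise. *)
Lemma DcostE : (Hsum R N O L A P sinit pact Starg Savoid < +oo)%E ->
  Dcost R N O L A K P sinit pact pcomm Starg Savoid q
  = (\sum_(0 <= n <oo) (costTerm n)%:E)%E.
Proof.
move=> Hoo.
have H0 : (0 <= Hsum R N O L A P sinit pact Starg Savoid)%E.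
  by apply: nneseries_ge0 => n _ _; rewrite lee_fin Hent_ge0.
have Hfin : Hsum R N O L A P sinit pact Starg Savoid \is a fin_num.
  by rewrite ge0_fin_numE.
rewrite /Dcost -(addeK (\sum_(0 <= n <oo) (costTerm n)%:E)%E Hfin).
congr (_ - _)%E.
rewrite /Hsum -nneseriesD; last 2 first.
- by move=> n _ _; rewrite lee_fin costTerm_ge0.
- by move=> n _ _; rewrite lee_fin Hent_ge0.
rewrite /Gi /Gc -nneseries_sum; last by move=> i n _; rewrite lee_fin agentTerm_ge0.
rewrite -nneseries_sum; last by move=> c n _; rewrite lee_fin groupTerm_ge0.
rewrite -nneseriesD; last 2 first.
- by move=> n _ _; apply: sume_ge0 => i _; rewrite lee_fin agentTerm_ge0.
- by move=> n _ _; apply: sume_ge0 => c _; rewrite lee_fin groupTerm_ge0.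
apply: eq_eseriesr => n _; rewrite !sumEFin -!EFinD; congr EFin.
by rewrite /costTerm subrK.
Qed.

Local Notation reachN := (reachN R N O L A sinit Starg Savoid).

Lemma reach_gap_bound n :
  (Hsum R N O L A P sinit pact Starg Savoid < +oo)%E ->
  \sum_(m < n) reachN kf m - \sum_(m < n) reachN kh m
  <= bound R (Dcost R N O L A K P sinit pact pcomm Starg Savoid q).
Proof.
move=> Hoo.
have kh0 m : 0 <= reachN kh m.
  by apply: sumr_ge0 => h _; apply: pathW_ge0 => *; exact: khat_ge0.
have kf1 : \sum_(m < n) reachN kf m - \sum_(m < n) reachN kh m <= 1.
  rewrite lerBlDr -[leLHS]addr0 lerD ?sumr_ge0//.
  apply: (sum_reachN_le1 _ _ _ _ _ _ _ _ kf) => *; rewrite ?sum_kfull//;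
    exact: kfull_ge0.
(* For an infinite cost [bound] is 1, and [kf1] suffices. *)
case E: (Dcost _ _ _ _ _ _ _ _ _ _ _ _ _) => [r||]//=.
(* [n.+1] reach terms correspond to horizon [n]; the empty sum is treated apart. *)
case: n kf1 => [|n] _; first by rewrite !big_ord0 subrr sqrtr_ge0.
apply: (le_trans (reach_gap R N O L A sinit Starg Savoid kf kh _ _ _ _ _ n)) => *.
- exact: kfull_ge0.
- exact: sum_kfull.
- exact: khat_ge0.
- exact: sum_khat_le1.
- exact: khat_gt0.
rewrite ler_wsqrtr// lerD2l lerN2 ler_expR lerN2.
apply: (@le_trans _ _ (\sum_(m < n) costTerm m)).
  by apply: ler_sum => m _; exact: stepKL_le.
rewrite -lee_fin -E DcostE// -sumEFin -(big_mkord xpredT (fun m => (costTerm m)%:E)).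
by apply: nneseries_lim_ge => m _ _; rewrite lee_fin costTerm_ge0.
Qed.

End Game.

(** * Passage to the limit in the horizon *)

Theorem theorem1 (R : realType) (N : nat) (O L A : 'I_N -> finType) (K : nat)
  (P : forall i : 'I_N, (O i * L i)%type -> A i -> {ffun (O i * L i)%type -> R})
  (sinit : jS N O L)
  (pcomm : jO N O -> {ffun Acomm N K -> R})
  (pact : jS N O L -> {ffun jA N A -> R})
  (Starg Savoid : {set jS N O L})
  (q : q_family R N O L A) :
  (K <= N)%N ->
  (forall i s a, is_dist R _ (P i s a)) ->
  (forall o, is_dist R _ (pcomm o)) ->
  (forall s, is_dist R _ (pact s)) ->
  [disjoint Starg & Savoid] ->
  is_cond_family R N O L A P sinit pact Starg Savoid q ->
  (Hsum R N O L A P sinit pact Starg Savoid < +oo)%E ->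
  (reachP R N O L A sinit Starg Savoid (kfull R N O L A P pact)
   - reachP R N O L A sinit Starg Savoid (khat R N O L A K pcomm q)
   <= (bound R (Dcost R N O L A K P sinit pact pcomm Starg Savoid q))%:E)%E.
Proof.
move=> _ Pd cd ad _ qc Hoo.
set kf := kfull R N O L A P pact; set kh := khat R N O L A K pcomm q.
have kf0 m : 0 <= reachN R N O L A sinit Starg Savoid kf m.
  by apply: sumr_ge0 => h _; apply: pathW_ge0 => *; exact: kfull_ge0.
have kh0 m : 0 <= reachN R N O L A sinit Starg Savoid kh m.
  apply: sumr_ge0 => h _; apply: pathW_ge0 => *.
  exact: (khat_ge0 _ _ _ _ _ _ _ _ _ _ _ _ _ Pd cd ad qc).
have kh_ge0 : (0 <= reachP R N O L A sinit Starg Savoid kh)%E.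
  by apply: nneseries_ge0 => n _ _; rewrite lee_fin; exact: kh0.
(* Finiteness allows the subtracted probability to be moved to the right-hand side. *)
have khfin : reachP R N O L A sinit Starg Savoid kh \is a fin_num.
  rewrite ge0_fin_numE//; apply: (@le_lt_trans _ _ 1%E); last exact: ltry.
  apply: lime_le.
    by apply: is_cvg_nneseries => n _ _; rewrite lee_fin; exact: kh0.
  apply: nearW => n; rewrite big_mkord sumEFin lee_fin.
  apply: (sum_reachN_le1 _ _ _ _ _ _ _ _ kf) => *.
  - exact: kfull_ge0.
  - exact: sum_kfull.
  - exact: (khat_ge0 _ _ _ _ _ _ _ _ _ _ _ _ _ Pd cd ad qc).
  - exact: (sum_khat_le1 _ _ _ _ _ _ _ _ _ _ _ _ _ Pd cd ad qc).
rewrite leeBlDr//; apply: lime_le.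
  by apply: is_cvg_nneseries => n _ _; rewrite lee_fin; exact: kf0.
apply: nearW => n; rewrite big_mkord sumEFin.
(* The gap is bounded at equal horizons first; the partial sum for [kh] is then enlarged to its
   series. *)
apply: (@le_trans _ _
  ((bound R (Dcost R N O L A K P sinit pact pcomm Starg Savoid q))%:E +
   (\sum_(m < n) reachN R N O L A sinit Starg Savoid kh m)%:E)%E).
  rewrite -EFinD lee_fin -lerBlDr; exact: reach_gap_bound.
rewrite leeD2l// -sumEFin
  -(big_mkord xpredT (fun m => (reachN R N O L A sinit Starg Savoid kh m)%:E)).
by apply: nneseries_lim_ge => m _ _; rewrite lee_fin; exact: kh0.
Qed.
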